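(* Let $\mathcal{A}\in\mathbb{R}^{I\times J\times K}$ and $\mathbf{B}\in\mathbb{R}^{I\times J}$, and define $\phi_1:\mathbb{R}^K\to\mathbb{R}$ by $\phi_1(\mathbf{x})=\Vert\mathcal{A}\bullet_3\mathbf{x}-\mathbf{B}\Vert_F^2$. Then any minimizer $\bar{\mathbf{x}}\in\mathbb{R}^K$ of $\phi_1$ satisfies the system $$\mathcal{A}^T\ast_2\mathcal{A}\bullet_3\mathbf{x}=\mathcal{A}^T\ast_2\mathbf{B}.$$
   Context: For $\mathcal{A}\in\mathbb{R}^{I\times J\times K}$ and $\mathbf{x}\in\mathbb{R}^K$, $\mathcal{A}\bullet_3\mathbf{x}\in\mathbb{R}^{I\times J}$ is $(\mathcal{A}\bullet_3\mathbf{x})_{ij}=\sum_{k=1}^{K}a_{ijk}x_k$. The transpose $\mathcal{A}^T\in\mathbb{R}^{K\times I\times J}$ is $(\mathcal{A}^T)_{kij}=a_{ijk}$. The product $\ast_2$ contracts the last two indices of the left factor with the first two indices of the right factor: $(\mathcal{A}^T\ast_2\mathcal{A})_{kl}=\sum_{i,j}(\mathcal{A}^T)_{kij}a_{ijl}$ (a $K\times K$ matrix), $(\mathcal{A}^T\ast_2\mathbf{M})_k=\sum_{i,j}(\mathcal{A}^T)_{kij}m_{ij}$ for $\mathbf{M}\in\mathbb{R}^{I\times J}$; the expression $\mathcal{A}^T\ast_2\mathcal{A}\bullet_3\mathbf{x}$ is $\mathcal{A}^T\ast_2(\mathcal{A}\bullet_3\mathbf{x})=(\mathcal{A}^T\ast_2\mathcal{A})\mathbf{x}$.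 The Frobenius norm is the square root of the sum of squares of all entries. *)

(* Defs.v *)
From mathcomp Require Import all_boot all_order all_algebra.
From mathcomp Require Import reals.
Set Implicit Arguments.
Unset Strict Implicit.
Unset Printing Implicit Defensive.
Import Order.TTheory GRing.Theory Num.Theory.
Local Open Scope ring_scope.

Definition tensor3 (R : Type) (m n p : nat) := {ffun 'I_m * 'I_n * 'I_p -> R}.

Definition tensor3_mulv (R : realType) (m n p : nat)
    (A : tensor3 R m n p) (x : 'cV[R]_p) : 'M[R]_(m, n) :=
  \matrix_(i, j) \sum_(k < p) A (i, j, k) * x k 0.

(* A cyclic shift: the last index becomes the first. *)
Definition tensor3_tr (R : Type) (m n p : nat)
    (A : tensor3 R m n p) : tensor3 R p m n :=
  [ffun t : 'I_p * 'I_m * 'I_n => A (t.1.2, t.2, t.1.1)].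

(* The product *_2 takes two forms, according to whether the right factor has
   order 3 (tensor3_contract) or order 2 (tensor3_contractm). *)
Definition tensor3_contract (R : realType) (p m n q : nat)
    (C : tensor3 R p m n) (D : tensor3 R m n q) : 'M[R]_(p, q) :=
  \matrix_(k, l) \sum_(i < m) \sum_(j < n) C (k, i, j) * D (i, j, l).

Definition tensor3_contractm (R : realType) (p m n : nat)
    (C : tensor3 R p m n) (M : 'M[R]_(m, n)) : 'cV[R]_p :=
  \col_k \sum_(i < m) \sum_(j < n) C (k, i, j) * M i j.

Definition frobenius_norm (R : realType) (m n : nat) (M : 'M[R]_(m, n)) : R :=
  Num.sqrt (\sum_(i < m) \sum_(j < n) M i j ^+ 2).

Definition phi1 (R : realType) (m n p : nat)
    (A : tensor3 R m n p) (B : 'M[R]_(m, n)) (x : 'cV[R]_p) : R :=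
  frobenius_norm (tensor3_mulv A x - B) ^+ 2.

Definition is_minimizer (R : realType) (T : Type) (f : T -> R) (x : T) : Prop :=
  forall y : T, f x <= f y.

(* The two bracketings of C *_2 D •_3 x agree. *)
Lemma tensor3_contractA (R : realType) (p m n q : nat)
    (C : tensor3 R p m n) (D : tensor3 R m n q) (x : 'cV[R]_q) :
  tensor3_contractm C (tensor3_mulv D x) = tensor3_contract C D *m x.
Proof.
apply/colP => k; rewrite !mxE.
transitivity (\sum_(l < q) \sum_(i < m) \sum_(j < n)
                C (k, i, j) * D (i, j, l) * x l 0).
  rewrite [RHS]exchange_big; apply: eq_bigr => i _.
  rewrite [RHS]exchange_big; apply: eq_bigr => j _.
  by rewrite mxE mulr_sumr; apply: eq_bigr => l _; rewrite mulrA.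
apply: eq_bigr => l _; rewrite mxE mulr_suml; apply: eq_bigr => i _.
by rewrite mulr_suml.
Qed.

(* Main.v *)
Require Import Defs.
From mathcomp Require Import all_boot all_order all_algebra.
From mathcomp Require Import reals ring.
Import Order.TTheory GRing.Theory Num.Theory.
Local Open Scope ring_scope.

(** With residual [r] and [g := A^T *_2 r], moving from a minimizer along [t *: g]
    changes [phi1] by [2 t |g|^2 + t^2 |A •_3 g|^2]; this is nonnegative for
    every real [t] only if [g = 0]. *)

(** The vector [g] is half the gradient of [phi1] at the minimizer, and [g = 0] is the normal
    equation by linearity ([tensor3_contractmB]). No derivative is taken: [phi1DZ] gives the exact
    increment, and [quadratic_ge0_linear_coef0] forces its linear coefficient, the squared length of
    [g], to vanish. *)

Lemma phi1E (R : realType) (m n p : nat)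
    (A : tensor3 R m n p) (B : 'M[R]_(m, n)) (x : 'cV[R]_p) :
  phi1 A B x = \sum_i \sum_j (tensor3_mulv A x - B) i j ^+ 2.
Proof.
by rewrite /phi1 sqr_sqrtr// sumr_ge0// => i _; rewrite sumr_ge0// => j _;
  rewrite sqr_ge0.
Qed.

Lemma tensor3_mulvDZ (R : realType) (m n p : nat)
    (A : tensor3 R m n p) (x y : 'cV[R]_p) (t : R) :
  tensor3_mulv A (x + t *: y) = tensor3_mulv A x + t *: tensor3_mulv A y.
Proof.
apply/matrixP => i j; rewrite !mxE mulr_sumr -big_split; apply: eq_bigr => k _.
by rewrite !mxE /=; ring.
Qed.

Lemma tensor3_contractmB (R : realType) (p m n : nat)
    (C : tensor3 R p m n) (M N : 'M[R]_(m, n)) :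
  tensor3_contractm C (M - N) = tensor3_contractm C M - tensor3_contractm C N.
Proof.
apply/colP => k; rewrite !mxE -sumrB; apply: eq_bigr => i _.
by rewrite -sumrB; apply: eq_bigr => j _; rewrite !mxE mulrBr.
Qed.

(** Both sides are the triple sum of [A (i, j, k) * M i j * y k 0], taken in different orders. This
    moves [A] off [y] in the cross term of the expanded square. *)
Lemma tensor3_tr_adjoint (R : realType) (m n p : nat)
    (A : tensor3 R m n p) (M : 'M[R]_(m, n)) (y : 'cV[R]_p) :
  \sum_i \sum_j M i j * tensor3_mulv A y i j
  = \sum_k tensor3_contractm (tensor3_tr A) M k 0 * y k 0.
Proof.
transitivity (\sum_i \sum_k \sum_j A (i, j, k) * M i j * y k 0).
  apply: eq_bigr => i _; rewrite exchange_big; apply: eq_bigr => j _.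
  by rewrite mxE mulr_sumr; apply: eq_bigr => k _; rewrite mulrCA mulrA.
rewrite exchange_big; apply: eq_bigr => k _; rewrite mxE mulr_suml.
by apply: eq_bigr => i _; rewrite mulr_suml; apply: eq_bigr => j _; rewrite ffunE.
Qed.

Lemma phi1DZ (R : realType) (m n p : nat)
    (A : tensor3 R m n p) (B : 'M[R]_(m, n)) (x y : 'cV[R]_p) (t : R) :
  phi1 A B (x + t *: y) = phi1 A B x
    + 2 * t * (\sum_k tensor3_contractm (tensor3_tr A) (tensor3_mulv A x - B) k 0
                      * y k 0)
    + t ^+ 2 * \sum_i \sum_j tensor3_mulv A y i j ^+ 2.
Proof.
rewrite -tensor3_tr_adjoint !phi1E !mulr_sumr -!big_split; apply: eq_bigr => i _.
rewrite !mulr_sumr -!big_split; apply: eq_bigr => j _.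
(* Generalizing the two products keeps [mxE] from unfolding them into sums, so [ring] sees plain
   entries. *)
by rewrite tensor3_mulvDZ; move: (tensor3_mulv A x) (tensor3_mulv A y) => M N;
  rewrite !mxE /=; ring.
Qed.

Lemma quadratic_ge0_linear_coef0 (R : realFieldType) (s q : R) :
  0 <= q -> (forall t, 0 <= 2 * t * s + t ^+ 2 * q) -> s = 0.
Proof.
(* The quadratic is least at [- s / q] when [q > 0]; the shifted denominator [q + 1] also covers
   [q = 0] and still gives a negative value unless [s = 0]. *)
move=> q0 /(_ (- s / (q + 1))).
have q1 : q + 1 != 0 by rewrite lt0r_neq0// ltr_wpDl.
have -> : 2 * (- s / (q + 1)) * s + (- s / (q + 1)) ^+ 2 * q
          = - ((q + 2) * (s / (q + 1)) ^+ 2) by field.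
rewrite oppr_ge0 pmulr_rle0 ?ltr_wpDl// => h.
have : (s / (q + 1)) ^+ 2 == 0 by rewrite eq_le h sqr_ge0.
by rewrite sqrf_eq0 mulf_eq0 invr_eq0 (negPf q1) orbF => /eqP.
Qed.

Theorem lemma6p2 (R : realType) (m n p : nat)
    (A : tensor3 R m n p) (B : 'M[R]_(m, n)) (xbar : 'cV[R]_p) :
  is_minimizer (phi1 A B) xbar ->
  tensor3_contractm (tensor3_tr A) (tensor3_mulv A xbar)
  = tensor3_contractm (tensor3_tr A) B.
Proof.
move=> xmin; apply/subr0_eq; rewrite -tensor3_contractmB.
set g := tensor3_contractm _ _.
have g0 : \sum_k g k 0 * g k 0 = 0.
  apply: (@quadratic_ge0_linear_coef0 _ _
            (\sum_i \sum_j tensor3_mulv A g i j ^+ 2)) => [|t].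
    by apply: sumr_ge0 => i _; apply: sumr_ge0 => j _; rewrite sqr_ge0.
  (* Taking [g] itself as the direction turns the linear coefficient into a sum of squares. *)
  by have := xmin (xbar + t *: g); rewrite phi1DZ -addrA lerDl.
have gk : forall k, true -> g k 0 * g k 0 = 0.
  by apply: psumr_eq0P g0 => k _; rewrite -expr2 sqr_ge0.
by apply/colP => k; apply/eqP; rewrite [X in _ == X]mxE -sqrf_eq0 expr2 gk.
Qed.
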